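(* Suppose that $\chi=(P,Q,0)$ is a pseudo-type-$n$ vector field in $\mathbb{R}^3$. Then $\chi$ is a vector field on $\mathbb{T}^2$ if and only if there exists a homogeneous polynomial $A\in\mathbb{R}[x,y,z]$ of degree $n-1$ such that $P=Ay$ and $Q=-Ax$. Furthermore, any pseudo-type-$n$ vector field on $\mathbb{T}^2$ is completely integrable.
   Context: Fix a real number $a>1$ and let $\mathbb{T}^2=\{(x,y,z)\in\mathbb{R}^3:(x^2+y^2-a^2)^2+z^2-1=0\}$. A triple $\chi=(P,Q,R)$ with $P,Q,R\in\mathbb{R}[x,y,z]$ denotes the polynomial vector field $P\frac{\partial}{\partial x}+Q\frac{\partial}{\partial y}+R\frac{\partial}{\partial z}$ in $\mathbb{R}^3$, acting on polynomials as a derivation. It is called a vector field on $\mathbb{T}^2$ if $\chi F=KF$ for some $K\in\mathbb{R}[x,y,z]$, where $F=(x^2+y^2-a^2)^2+z^2-1$. It is called a pseudo-type-$n$ vector field if $P,Q$ are homogeneous polynomials of degree $n$ and $R=0$. A first integral of $\chi$ on an open set $U\subset\mathbb{R}^3$ is a non-constant analytic map $H:U\to\mathbb{R}$ that is constant on all solution curves of $\chi$ contained in $U$ (equivalently $\chi H=0$ on $U$). A vector field in $\mathbb{R}^n$ is completely integrable if it has $n-1$ functionally independent first integrals (so two of them in $\mathbb{R}^3$). *)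

(* Defs.v *)
From HB Require Import structures.
From mathcomp Require Import all_boot all_order all_algebra.
From mathcomp Require Import all_classical all_reals all_analysis.
(* Several notations of mpoly clash with those of MathComp-Analysis. *)
From mathcomp Require Import -(notations) mpoly.

Set Implicit Arguments.
Unset Strict Implicit.
Unset Printing Implicit Defensive.

Import Order.TTheory GRing.Theory Num.Theory.
Import numFieldNormedType.Exports.

Local Open Scope classical_set_scope.
Local Open Scope ring_scope.

Notation poly3 R := (mpoly 3 R).
Notation point R := 'rV[R]_3.

Section VectorFields.
Variable R : realType.

Definition xvar : poly3 R := mpolyX R (mnm1 (0 : 'I_3)).
Definition yvar : poly3 R := mpolyX R (mnm1 (1 : 'I_3)).
Definition zvar : poly3 R := mpolyX R (mnm1 (2 : 'I_3)).

(* The zero polynomial is homogeneous of every degree. *)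
Definition homogeneous (n : nat) (p : poly3 R) : Prop :=
  p \is @ishomog1 3 R n mdeg.

Definition peval (p : poly3 R) (v : point R) : R := meval (fun i => v 0 i) p.

(* (P, Q, W) stands for P d/dx + Q d/dy + W d/dz. *)
Definition vfield : Type := (poly3 R * poly3 R * poly3 R)%type.

Definition vf_apply (chi : vfield) (f : poly3 R) : poly3 R :=
  let: (P, Q, W) := chi in
  P * mderiv 0 f + Q * mderiv 1 f + W * mderiv 2 f.

Definition vf_at (chi : vfield) (v : point R) : point R :=
  let: (P, Q, W) := chi in
  \row_i tnth [tuple peval P v; peval Q v; peval W v] i.

Definition torus_poly (a : R) : poly3 R :=
  (xvar ^+ 2 + yvar ^+ 2 - mpolyC 3 (a ^+ 2)) ^+ 2 + zvar ^+ 2 - 1.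

Definition vfield_on_torus (a : R) (chi : vfield) : Prop :=
  exists K : poly3 R, vf_apply chi (torus_poly a) = K * torus_poly a.

Definition pseudo_type (n : nat) (chi : vfield) : Prop :=
  let: (P, Q, W) := chi in [/\ homogeneous n P, homogeneous n Q & W = 0].

Definition monomial (m : multinom 3) (h : point R) : R :=
  \prod_(i < 3) h 0 i ^+ m i.

(* bmultinom 3 N is the type of the multi-indices of total degree < N, so the
   limits below are taken over N. The absolute convergence in the first clause
   makes the sum independent of this way of ordering the terms. *)
Definition analytic_at (H : point R -> R) (v : point R) : Prop :=
  exists c : multinom 3 -> R, \forall w \near v,
    cvgn (fun N => \sum_(m : bmultinom 3 N) `|c m * monomial m (w - v)|) /\
    (fun N => \sum_(m : bmultinom 3 N) c m * monomial m (w - v)) @ \oo --> H w.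

Definition solution_curve (chi : vfield) (J : set R) (gamma : R -> point R) :
    Prop :=
  [/\ open J, is_interval J &
      forall t, J t -> is_derive t 1 gamma (vf_at chi (gamma t))].

Definition first_integral (chi : vfield) (U : set (point R))
    (H : point R -> R) : Prop :=
  [/\ open U,
      forall v, U v -> analytic_at H v,
      exists v w, [/\ U v, U w & H v <> H w] &
      forall J gamma, solution_curve chi J gamma ->
        (forall t, J t -> U (gamma t)) ->
        forall s t, J s -> J t -> H (gamma s) = H (gamma t)].

Definition jacobian_mx k (H : 'I_k -> point R -> R) (v : point R) :
    'M[R]_(k, 3) :=
  \matrix_(i, j) 'D_(delta_mx 0 j) (H i) v.

Definition row3 (t : R * R * R) : point R :=
  \row_i tnth [tuple t.1.1; t.1.2; t.2] i.

Definition lebesgue_measure3 :=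
  (((@lebesgue_measure R \x @lebesgue_measure R) \x @lebesgue_measure R)%E).

(* The gradients are linearly independent at almost every point of U. *)
Definition functionally_independent k (U : set (point R))
    (H : 'I_k -> point R -> R) : Prop :=
  lebesgue_measure3.-negligible
    [set t | U (row3 t) /\ ~~ row_free (jacobian_mx H (row3 t))].

(* The first integrals are required on the whole of R^3: on a small
   neighbourhood of a point where chi does not vanish, two of them always exist,
   by the flow-box theorem. *)
Definition completely_integrable (chi : vfield) : Prop :=
  exists H : 'I_2 -> point R -> R,
    (forall i, first_integral chi setT (H i)) /\
    functionally_independent setT H.

End VectorFields.

(* Main.v *)
(** Write r2 for x^2 + y^2, S for xP + yQ and F for the torus polynomial.
    Tangency reads 4 S (r2 - a^2) = K F. If S <> 0, the left-hand side lives in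
    the degrees n + 1 and n + 3; since F has a non-zero constant term a^4 - 1
    and degree 4, K would have no term of degree < n + 1 and degree at most
    n - 1. Hence xP + yQ = 0, and y divides P. The field (Ay, -Ax, 0)
    kills x^2 + y^2 and z, which are the two first integrals; their gradients
    are independent off the null set x = 0. *)
Require Import Defs.
From mathcomp Require Import all_boot all_order all_algebra.
From mathcomp Require Import all_classical all_reals all_analysis.
From mathcomp Require Import -(notations) mpoly.
From mathcomp Require Import ssrcomplements ring lra zify.
Import Order.TTheory GRing.Theory Num.Theory.
Import numFieldNormedType.Exports.
Set Implicit Arguments.
Unset Strict Implicit.
Unset Printing Implicit Defensive.
Local Open Scope ring_scope.

(** * Coefficients, supports and divisibility of polynomials *)

Lemma mpoly_ring_ind n (R : nzRingType) (K : mpoly n R -> Prop) :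
  (forall c, K (mpolyC n c)) -> (forall i, K (mpolyX R (mnm1 i))) ->
  (forall p q, K p -> K q -> K (p + q)) ->
  (forall p q, K p -> K q -> K (p * q)) -> forall p, K p.
Proof.
move=> KC KX KD KM p; rewrite [p]mpolyE.
elim/big_ind: _ => [||m _]; [by rewrite -mpolyC0|exact: KD|].
rewrite -mul_mpolyC mpolyXE_id; apply: (KM) => //.
elim/big_ind: _ => [||i _]; [by rewrite -mpolyC1|exact: KM|].
elim: (m i) => [|k IHk]; first by rewrite expr0 -mpolyC1.
by rewrite exprS; apply: KM.
Qed.

(** In the coefficient of [m] in [p * q], every term other than p_m q_0 contains a coefficient of
    [p] of smaller degree. Induction on the degree removes these terms, and q_0 can be cancelled in
    a domain. *)
Lemma mcoeff_lowM n (R : idomainType) (p q : mpoly n R) d :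
  mcoeff mnm0 q != 0 ->
  (forall m, (mdeg m < d)%N -> mcoeff m (p * q) = 0) ->
  forall m, (mdeg m < d)%N -> mcoeff m p = 0.
Proof.
move=> q0 pq0 m; have [k] := ubnP (mdeg m).
elim: k m => // k IHk m; rewrite ltnS => mk md.
have /eqP := pq0 m md; rewrite mcoeffM.
pose i : bmultinom n (mdeg m).+1 := BMultinom (ltnSn (mdeg m)).
have lt0 : (mdeg (mnm0 : multinom n) < (mdeg m).+1)%N by rewrite mdeg0.
rewrite (bigD1 (i, BMultinom lt0)) /= ?addm0// big1 ?addr0.
  by rewrite mulf_eq0 (negPf q0) orbF => /eqP.
case=> [[m1 h1] [m2 h2]] /= /andP[/eqP mE ne].
have m2_gt0 : (0 < mdeg m2)%N.
  rewrite lt0n mdeg_eq0; apply: contra ne => /eqP m20.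
  by rewrite -pair_eqE /= !bmeqP /= mE m20 addm0 !eqxx.
have m1_lt : (mdeg m1 < mdeg m)%N by rewrite mE mdegD -ltn_subLR ?subnn.
by rewrite IHk ?mul0r// (leq_trans m1_lt)// ltnW.
Qed.

Lemma dvd_mpolyX n (R : nzRingType) (p : mpoly n R) i :
  (forall m : multinom n, m i = 0%N -> mcoeff m p = 0) ->
  exists q, p = q * mpolyX R (mnm1 i).
Proof.
move=> p0.
(* [mnm_sub] truncates at 0, but each [m] in the support has a positive exponent at [i], so nothing
   is lost. *)
exists (\sum_(m <- msupp p) mcoeff m p *: mpolyX R (mnm_sub m (mnm1 i))).
rewrite mulr_suml {1}[p]mpolyE big_seq [RHS]big_seq; apply: eq_bigr => m mp.
rewrite -scalerAl -mpolyXD submK// lep1mP.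
by apply: contraTneq mp => /p0 pm; rewrite mcoeff_msupp pm eqxx.
Qed.

Lemma mderivXU n (R : nzRingType) (i j : 'I_n) :
  mderiv i (mpolyX R (mnm1 j)) = (j == i)%:R.
Proof.
rewrite mderivX mnm1E; case: eqP => [->|_]; last by rewrite scale0r.
by rewrite scale1r -{1}[mnm1 i]add0m addmK mpolyX0.
Qed.

(** * Tangency to the torus *)

Section TangentPolynomials.
Variable R : realType.

(** [msize] is the degree plus one, except that it is 0 at the zero polynomial; hence only an
    inequality. *)
Lemma msize_dhomog_le d (p : poly3 R) : homogeneous d p -> (msize p <= d.+1)%N.
Proof.
move=> hp; have [->|p0] := eqVneq p 0; first by rewrite mmeasure0.
by rewrite (dhomog_uniq p0 hp (dhomog_msize hp)) leqSpred.
Qed.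

(** Multiplication by a variable raises the degree of each monomial of [A] by one. If [d] is 0, this
    forces [A] to be zero, so the truncated [d.-1] is harmless. *)
Lemma homogeneous_mulXU i d (A : poly3 R) :
  homogeneous d (A * mpolyX R (mnm1 i)) -> homogeneous d.-1 A.
Proof.
move=> /dhomogP hA; apply/dhomogP => m mA.
rewrite -(hA (mnm_add (mnm1 i) m)); last first.
  by rewrite mcoeff_msupp mcoeffMX -mcoeff_msupp.
by rewrite /= mdegD mdeg1.
Qed.

(** A monomial of [P] free of y would give, after multiplication by x, a monomial that no term of yQ
    cancels. So y divides [P], and cancelling y in the relation yields [Q]. *)
Lemma euler_syzygy (P Q : poly3 R) : xvar R * P + yvar R * Q = 0 ->
  exists A, P = A * yvar R /\ Q = - A * xvar R.
Proof.
move=> S0; have [|A PA] := @dvd_mpolyX _ _ P 1.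
  move=> m m1; have /(congr1 (mcoeff (mnm_add (mnm1 (0 : 'I_3)) m))) := S0.
  rewrite mcoeff0 mcoeffD mulrC /xvar mcoeffMX => E.
  rewrite -[LHS]addr0 -[RHS]E.
  congr (_ + _); apply/esym/eqP; rewrite mcoeff_eq0; apply/negP.
  rewrite mulrC (perm_mem (msuppMX _ _)) => /mapP[k _] /mnmP /(_ 1).
  by rewrite !mnmDE !mnm1E m1 eqxx.
exists A; split => //; apply: (@mulfI _ (yvar R)).
  by rewrite -(mmeasure_poly_eq0 mdeg) msizeX.
by apply/eqP; rewrite -subr_eq0 -S0 PA /yvar; apply/eqP; ring.
Qed.

Lemma vf_apply_torus a (P Q : poly3 R) :
  vf_apply (P, Q, 0) (torus_poly a) =
  4%:R * (xvar R * P + yvar R * Q) *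
    (xvar R ^+ 2 + yvar R ^+ 2 - mpolyC 3 (a ^+ 2)).
Proof.
rewrite /vf_apply /torus_poly !expr2 -mpolyC1.
rewrite !(mderivD, mderivN, mderivM, mderivC, mderivXU) /=; ring.
Qed.

Lemma tangent_syzygy a n (P Q : poly3 R) : 1 < a ->
  homogeneous n P -> homogeneous n Q -> vfield_on_torus a (P, Q, 0) ->
  xvar R * P + yvar R * Q = 0.
Proof.
move=> a1 hP hQ [K]; rewrite vf_apply_torus.
set S := (X in 4%:R * X); set r2 := _ ^+ 2 + _ ^+ 2.
set F := torus_poly a => KF.
have hX i : homogeneous 1 (mpolyX R (mnm1 i)).
  by rewrite /homogeneous dhomogX /= mdeg1.
have hXX i : homogeneous 2 (mpolyX R (mnm1 i) ^+ 2) := dhomogMn 2 (hX i).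
have hS : homogeneous n.+1 S by apply: rpredD; apply: (dhomogM (hX _)).
have hr2 : homogeneous 2 r2 by apply: rpredD; apply: hXX.
have a2 : 1 < a ^+ 2 by nra.
have cX i : mcoeff mnm0 (mpolyX R (mnm1 i)) = 0 by rewrite mcoeffX mnm1_eq0.
(* The point (1, 0, 0), where [r2] takes the value 1. *)
pose v : 'I_3 -> R := fun i => (i == 0)%:R.
have r2N0 : r2 != 0.
  apply/eqP => /(congr1 (meval v)).
  rewrite meval0 /r2 mevalD !rmorphXn/= !mevalXU /v /=; lra.
have F0 : mcoeff mnm0 F != 0.
  rewrite /F /torus_poly !(rmorphB, rmorphD, rmorphXn, rmorph1) /= !cX.
  rewrite mcoeffC eqxx mulr1 !expr0n !add0r sqrrN addr0 subr_eq0.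
  by rewrite gt_eqF// exprn_egt1.
have FN0 : F != 0 by apply: contraNneq F0 => ->; rewrite mcoeff0.
(* That is, [F] has degree at least 4: otherwise [r2 ^+ 2], which is [F] plus terms of degree at
   most 2, would have degree below 4. *)
have sF : (5 <= msize F)%N.
  rewrite leqNgt; apply/negP => sF.
  have : (msize (r2 ^+ 2) <= 4)%N.
    have -> : r2 ^+ 2 = F + (mpolyC 3 (2 * a ^+ 2) * r2
                       + (mpolyC 3 (1 - a ^+ 4) - zvar R ^+ 2)).
      rewrite /F /torus_poly -/r2 !(rmorphB, rmorphM, rmorphXn) /=.
      by rewrite rmorph1 rmorph_nat; ring.
    apply: leq_trans (mmeasureD_le _ _ _) _; rewrite geq_max -ltnS sF /=.
    apply: leq_trans (mmeasureD_le _ _ _) _; rewrite geq_max.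
    apply/andP; split.
      rewrite mul_mpolyC (leq_trans (msizeZ_le _ _))//.
      exact: leq_trans (msize_dhomog_le hr2) _.
    apply: leq_trans (mmeasureD_le _ _ _) _; rewrite geq_max.
    rewrite mmeasureC mmeasureN (leq_trans (leq_b1 _))//=.
    exact: leq_trans (msize_dhomog_le (hXX _)) _.
  have := dhomog_uniq r2N0 hr2 (dhomog_msize hr2).
  by rewrite expr2 msizeM//; case: (msize r2) => [|[|[|[]]]].
have [//|SN0] := eqVneq S 0.
have S4 : homogeneous n.+1 (4%:R * S) by rewrite /homogeneous mulr_natl rpredMn.
pose G : poly3 R := r2 - mpolyC 3 (a ^+ 2).
have GN0 : G != 0.
  apply/eqP => /(congr1 (mcoeff mnm0)).
  rewrite /G /r2 !(rmorphB, rmorphD, rmorphXn) /= !cX mcoeffC eqxx mcoeff0.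
  rewrite mulr1; nra.
have S4N0 : 4%:R * S != 0.
  by rewrite mulr_natl -scaler_nat scaler_eq0 (negPf SN0) pnatr_eq0.
have KN0 : K != 0.
  apply: contra_eq_neq KF => ->; rewrite mul0r mulf_neq0//.
(* The left-hand side of [KF] is the sum of 4 S r2 and - 4 a^2 S, homogeneous of degrees n + 3 and n
   + 1. *)
have low m : (mdeg m < n.+1)%N -> mcoeff m (K * F) = 0.
  move=> mn; rewrite -KF mulrBr mcoeffB mulrC [_ * mpolyC _ _]mulrC mcoeffCM.
  rewrite (dhomog_nemf_coeff S4) ?ltn_eqF//.
  rewrite (dhomog_nemf_coeff (dhomogM hr2 S4)) ?ltn_eqF// ?mulr0 ?subr0//.
  by rewrite ltn_addl.
(* By [mcoeff_lowM], the leading monomial of [K] cannot have degree below n + 1. *)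
have sK : (n.+2 <= msize K)%N.
  have := msize_mdeg_lt (mlead_supp KN0); apply: leq_trans; rewrite ltnNge.
  apply: contraTN (mlead_supp KN0) => lt; rewrite -mcoeff_eq0.
  by rewrite (mcoeff_lowM F0 low).
have : (msize (K * F) <= n + 4)%N.
  rewrite -KF -/G msizeM//.
  have s1 := msize_dhomog_le S4.
  have s2 : (msize G <= 3)%N.
    apply: leq_trans (mmeasureD_le _ _ _) _; rewrite geq_max msize_dhomog_le//.
    by rewrite mmeasureN mmeasureC (leq_trans (leq_b1 _)).
  rewrite -subn1 leq_subLR; apply: leq_trans (leq_add s1 s2) _; lia.
(* Degrees add in a domain: [K * F] has degree at least (n + 1) + 4, against the upper bound n +
   3. *)
rewrite msizeM// -subn1 leq_subLR => KF_le.
have := leq_trans (leq_add sK sF) KF_le; lia.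
Qed.
End TangentPolynomials.

(** * Polynomial functions along curves *)

Lemma sum_ord3 (V : nmodType) (F : 'I_3 -> V) :
  \sum_(i < 3) F i = F 0 + F 1 + F 2.
Proof.
rewrite !big_ord_recl big_ord0 addr0 addrA.
by congr (_ + F _ + F _); apply: val_inj.
Qed.

Lemma peval_add (R : realType) (p q : poly3 R) v :
  peval (p + q) v = peval p v + peval q v.
Proof. exact: mevalD. Qed.

Lemma peval_mul (R : realType) (p q : poly3 R) v :
  peval (p * q) v = peval p v * peval q v.
Proof. exact: mevalM. Qed.

Lemma is_derive_coord (R : realType) (V : normedModType R)
    (gamma : V -> 'rV[R]_3) (t u : V) (d : 'rV[R]_3) i :
  is_derive t u gamma d -> is_derive t u (fun s => gamma s 0 i) (d 0 i).
Proof.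
move=> [dgamma <-]; split; first by move/derivable_mxP : dgamma; apply.
by rewrite derive_mx// mxE.
Qed.

(** The chain rule, by induction on the construction of [p]. A general source [V] covers both
    solution curves ([V] the real line) and partial derivatives ([gamma] the identity of the
    space). *)
Lemma is_derive_peval_comp (R : realType) (V : normedModType R)
    (gamma : V -> 'rV[R]_3) (t u : V) (d : 'rV[R]_3) (p : poly3 R) :
  is_derive t u gamma d ->
  is_derive t u (fun s => peval p (gamma s))
    (\sum_(i < 3) d 0 i * peval (mderiv i p) (gamma t)).
Proof.
move=> dgamma; elim/mpoly_ring_ind: p => [c|j|p q dp dq|p q dp dq].
- under eq_bigr do rewrite mderivC /peval meval0 mulr0.
  rewrite big1//; under eq_fun do rewrite /peval mevalC; exact: is_derive_cst.
- under eq_fun do rewrite /peval mevalXU.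
  apply: is_derive_eq; first exact: is_derive_coord dgamma.
  rewrite (bigD1 j)//= mderivXU eqxx /peval meval1 mulr1 big1 ?addr0// => i ij.
  by rewrite mderivXU eq_sym (negPf ij) meval0 mulr0.
- rewrite (_ : (fun s => _) =
      (fun s => peval p (gamma s)) + (fun s => peval q (gamma s))); last first.
    by apply/funext => s; exact: peval_add.
  apply: is_derive_eq.
  rewrite -big_split; apply: eq_bigr => i _ /=.
  by rewrite mderivD peval_add mulrDr.
- rewrite (_ : (fun s => _) =
      (fun s => peval p (gamma s)) * (fun s => peval q (gamma s))); last first.
    by apply/funext => s; exact: peval_mul.
  apply: is_derive_eq.
  rewrite /GRing.scale/= !mulr_sumr -big_split; apply: eq_bigr => i _ /=.
  rewrite mderivM peval_add !peval_mul; ring.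
Qed.

(** By the chain rule, the derivative of [p] along the curve is the value of [vf_apply chi p], which
    is zero; the mean value theorem applies because [J] is an interval. *)
Lemma peval_constant_on_curve (R : realType) (chi : vfield R) (p : poly3 R)
    J gamma :
  vf_apply chi p = 0 -> solution_curve chi J gamma ->
  forall s t, J s -> J t -> peval p (gamma s) = peval p (gamma t).
Proof.
move=> chip [_ itvJ dgamma].
have dp t : J t -> is_derive t 1 (fun s => peval p (gamma s)) 0.
  move=> /dgamma/(@is_derive_peval_comp _ _ _ _ _ _ p); set S := \sum_(_ < _) _.
  suff -> : S = 0 by [].
  rewrite -[RHS](meval0 (fun i => gamma t 0 i)) -chip /S.
  case: chi {chip dgamma S} => [[P Q] W] /=.
  by rewrite sum_ord3 !mxE !(tnth_nth 0) !mevalD !mevalM.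
move=> s t; wlog st : s t / s <= t.
  move=> hw; have [st|/ltW ts] := leP s t => Js Jt.
    exact: hw.
  exact/esym/hw.
move=> Js Jt; have inJ x : x \in `[s, t] -> J x.
  by rewrite in_itv /= => sxt; apply: itvJ sxt.
have [||c _] := @MVT_segment R (fun x => peval p (gamma x)) (fun=> 0) s t st.
- by move=> x /subset_itv_oo_cc /inJ /dp.
- by apply: derivable_within_continuous => x /inJ /dp [].
- by rewrite mul0r => /eqP; rewrite subr_eq0 => /eqP.
Qed.

(** * Analyticity of polynomial functions *)

Lemma sum_bmultinom_msupp n (R : nzRingType) (V : nmodType) (p : mpoly n R) N
    (F : multinom n -> V) :
  (msize p <= N)%N -> (forall m, m \notin msupp p -> F m = 0) ->
  \sum_(m : bmultinom n N) F m = \sum_(m <- msupp p) F m.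
Proof.
move=> pN F0; pose I : subFinType _ := bmultinom n N.
rewrite [RHS](big_mksub I) /=; first last.
- by move=> m /msize_mdeg_lt /leq_trans; apply.
- by rewrite msupp_uniq.
by rewrite [RHS]big_rmcond// => m /F0.
Qed.

(** The power series at [v] is the translated polynomial [q], that is p(X + v). It has finitely many
    terms, so both sequences of partial sums are eventually constant, for every [w]. *)
Lemma analytic_peval (R : realType) (p : poly3 R) v : analytic_at (peval p) v.
Proof.
pose q := comp_mpoly [tuple mpolyX R (mnm1 i) + mpolyC 3 (v 0 i) | i < 3] p.
have pq w : peval p w = peval q (w - v).
  rewrite /peval comp_mpoly_meval; apply: meval_eq => i.
  by rewrite tnth_mktuple mevalD mevalXU mevalC !mxE subrK.
exists (fun m => mcoeff m q); apply: filterE => w.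
have nsupp m : m \notin msupp q -> mcoeff m q * monomial m (w - v) = 0.
  by rewrite -mcoeff_eq0 => /eqP ->; rewrite mul0r.
split.
  apply/cvg_ex; exists (\sum_(m <- msupp q) `|mcoeff m q * monomial m (w - v)|).
  apply: cvg_near_cst; near=> N; apply: sum_bmultinom_msupp => [|m mq].
    by near: N; exact: nbhs_infty_ge.
  by rewrite nsupp// normr0.
rewrite pq /peval mevalE.
apply: cvg_near_cst; near=> N; apply: (sum_bmultinom_msupp _ nsupp).
by near: N; exact: nbhs_infty_ge.
Unshelve. all: by end_near. Qed.

Lemma first_integral_peval (R : realType) (chi : vfield R) (p : poly3 R) v w :
  vf_apply chi p = 0 -> peval p v <> peval p w ->
  first_integral chi setT (peval p).
Proof.
move=> chip pvw; split; first exact: openT.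
- by move=> u _; exact: analytic_peval.
- by exists v, w.
- by move=> J gamma cJ _; exact: peval_constant_on_curve chip cJ.
Qed.

Lemma derive_peval (R : realType) (p : poly3 R) v j :
  'D_(delta_mx 0 j) (peval p) v = peval (mderiv j p) v.
Proof.
have [_ ->] := is_derive_peval_comp p
  (is_derive_id v (delta_mx 0 j : 'rV[R]_3)).
rewrite (bigD1 j)//= mxE !eqxx mul1r big1 ?addr0// => i ij.
by rewrite mxE (negPf ij) andbF mul0r.
Qed.

(** * Complete integrability *)

Lemma lebesgue_measure3_negligible_x0 (R : realType) :
  (@lebesgue_measure3 R).-negligible [set t | t.1.1 = 0].
Proof.
exists ([set 0] `*` setT `*` setT)%classic; split.
- by apply: measurableX => //; apply: measurableX.
- rewrite /lebesgue_measure3.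
  (* The other two factors have infinite measure; the convention that 0 times infinity is 0 settles
     the product. *)
  rewrite product_measure1E//; last exact: measurableX.
  have xy0 : (@lebesgue_measure R \x @lebesgue_measure R)%E
      ([set 0] `*` setT)%classic = 0%E.
    by rewrite product_measure1E// [X in (X * _)%E]lebesgue_measure_set1 mul0e.
  by rewrite [X in (X * _)%E]xy0 mul0e.
- by move=> [[x y] z] /= ->.
Qed.

(** The field is [A] times an infinitesimal rotation about the z-axis, which preserves the height
    and the distance to the axis. *)
Lemma completely_integrable_rotation (R : realType) (A : poly3 R) :
  completely_integrable (A * yvar R, - A * xvar R, 0).
Proof.
pose p : 'I_2 -> poly3 R :=
  fun i => if i == 0 then xvar R ^+ 2 + yvar R ^+ 2 else zvar R.
have p0 : p 0 = xvar R ^+ 2 + yvar R ^+ 2 by [].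
have p1 : p 1 = zvar R by [].
exists (fun i => peval (p i)); split.
  (* The points (0, 0, 0) and (1, 1, 1) witness that both functions are non-constant. *)
  move=> i; apply: (@first_integral_peval _ _ _ 0 (const_mx 1)).
    rewrite /p /vf_apply; case: (i == 0).
      rewrite !expr2 !(mderivD, mderivM, mderivXU) /=; ring.
    rewrite !mderivXU /=; ring.
  rewrite /p /peval; case: (i == 0).
    rewrite !(mevalD, rmorphXn) /= !mevalXU !mxE; lra.
  rewrite !mevalXU !mxE; lra.
apply: negligibleS (@lebesgue_measure3_negligible_x0 R) => -[[x y] z] [_].
apply: contraNeq => /= x0; apply: inj_row_free => u uJ.
have {}uJ j : u 0 0 * peval (mderiv j (p 0)) (row3 (x, y, z)) +
              u 0 1 * peval (mderiv j (p 1)) (row3 (x, y, z)) = 0.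
  have /matrixP/(_ 0 j) := uJ; rewrite !mxE big_ord_recl big_ord1.
  rewrite !mxE !derive_peval.
  by rewrite (_ : lift _ _ = 1)//; exact: val_inj.
(* The gradients are (2x, 2y, 0) and (0, 0, 1): the first column gives 2x u_0 = 0 with x nonzero,
   and the last one gives u_1 = 0. *)
have u0 : u 0 0 = 0.
  have := uJ 0; rewrite p0 p1 !expr2 !(mderivD, mderivM, mderivXU) /=.
  rewrite /peval !(mevalD, mevalM, meval0, meval1) !mevalXU mxE (tnth_nth 0) /=.
  rewrite !(mul0r, mulr0, mul1r, mulr1, addr0) => /eqP.
  by rewrite mulf_eq0 -mulr2n mulrn_eq0 orFb (negPf x0) orbF => /eqP.
have u1 : u 0 1 = 0.
  have := uJ 2; rewrite u0 mul0r add0r p1 mderivXU /peval meval1 mulr1; exact.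
apply/rowP => -[[|[|//]] i2]; rewrite mxE.
- by rewrite -[RHS]u0; congr (u 0 _); apply: val_inj.
- by rewrite -[RHS]u1; congr (u 0 _); apply: val_inj.
Qed.

Theorem theorem2p3 (R : realType) (a : R) (n : nat) (P Q : poly3 R) :
  1 < a -> pseudo_type n (P, Q, 0) ->
  (vfield_on_torus a (P, Q, 0) <->
     exists A : poly3 R,
       [/\ homogeneous n.-1 A, P = A * yvar R & Q = - A * xvar R]) /\
  (vfield_on_torus a (P, Q, 0) -> completely_integrable (P, Q, 0)).
Proof.
move=> a1 [hP hQ _].
have onT : vfield_on_torus a (P, Q, 0) ->
    exists A, P = A * yvar R /\ Q = - A * xvar R.
  by move=> /(tangent_syzygy a1 hP hQ)/euler_syzygy.
split; last by move=> /onT[A [-> ->]]; exact: completely_integrable_rotation.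
split=> [/onT[A [PA QA]]|[A [_ -> ->]]].
  by exists A; split => //; apply: (@homogeneous_mulXU _ 1); rewrite -[_ * _]PA.
(* Here xP + yQ vanishes, so the field annihilates the torus polynomial and the cofactor is 0. *)
by exists 0; rewrite vf_apply_torus; ring.
Qed.
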